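(* Let $a,b$ be positive real numbers with $a\neq b$. Then $\mathcal{G}_0(a,b)=0$, $\mathcal{G}_1(a,b)=1$, and for every integer $n\ge 2$, $$\mathcal{G}_{n}(a,b)+\sum_{k=0}^{n}\binom{n}{k}(\ln b-\ln a)^{n-k}\,\mathcal{G}_{k}(a,b)=2n\left(\ln\frac{1}{a}\right)^{n-1}.$$
   Context: For positive real numbers $a\neq b$, the Genocchi type numbers $\mathcal{G}_n(a,b)$ ($n\ge 0$) are defined by the generating function $$\frac{2t}{b^{t}+a^{t}}=\sum_{n=0}^{\infty}\mathcal{G}_{n}(a,b)\frac{t^{n}}{n!},\qquad |t|<\frac{\pi}{|\ln a-\ln b|}.$$ *)

(* Defs.v *)
From Stdlib Require Import Reals Factorial.
From Coquelicot Require Import Coquelicot.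
Open Scope R_scope.

(** [G] is the sequence of Genocchi type numbers of parameters [a] and [b]:
    its exponential generating function converges to [2t / (b^t + a^t)] on the
    whole interval [|t| < PI / |ln a - ln b|].  For [a, b > 0] and [a <> b]
    there is exactly one such sequence. *)
Definition is_genocchi_type (a b : R) (G : nat -> R) : Prop :=
  forall t : R, Rabs t < PI / Rabs (ln a - ln b) ->
    is_series (fun n : nat => G n * (t ^ n / INR (fact n)))
              (2 * t / (Rpower b t + Rpower a t)).

(* Main.v *)
Require Import Defs.
From Stdlib Require Import Reals Factorial Lra Lia.
From Coquelicot Require Import Coquelicot.
Open Scope R_scope.

(** Let [F t] be the generating function [2t / (b^t + a^t)] and put
    [c = ln b - ln a].  Since [b^t = a^t * exp (c t)], clearing the denominator
    gives [F t + F t * exp (c t) = 2 t * exp (- t ln a)] on the interval of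
    convergence.  Both sides are sums of power series there: the left one by the
    Cauchy product, which produces the binomial convolution of [G] with the
    powers of [c] after multiplication by [n!], the right one by shifting the
    exponential series.  A power series that converges near [0] is determined by
    its sum ([is_pseries_unique_coef]), so the coefficients agree; this is
    [genocchi_coef].  The recurrence is the equality of the coefficients of
    [t^n], and the coefficients of [1] and [t] give [G 0] and [G 1]. *)

(** The terms of a convergent series tend to [0], which fails strictly
    outside the disk of convergence. *)
Lemma is_pseries_CV_radius (u : nat -> R) (x l : R) :
  is_pseries u x l -> Rbar_le (Rabs x) (CV_radius u).
Proof.
  intros Hl.
  apply Rbar_not_lt_le; intros Hlt.
  apply (CV_disk_outside u x Hlt).
  apply is_pseries_R in Hl.
  apply ex_series_lim_0; exists l; exact Hl.
Qed.

Lemma is_pseries_CV_radius_lt (u : nat -> R) (f : R -> R) (r x : R) :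
  (forall t, Rabs t < r -> is_pseries u t (f t)) ->
  Rabs x < r -> Rbar_lt (Rabs x) (CV_radius u).
Proof.
  intros Hf Hx.
  (* The midpoint of [|x|] and [r] is still a point of convergence. *)
  set (y := (Rabs x + r) / 2).
  pose proof (Rabs_pos x) as Hx0.
  assert (Hy : Rabs y = y) by (apply Rabs_pos_eq; unfold y; lra).
  apply Rbar_lt_le_trans with (Rabs y).
  - rewrite Hy; simpl; unfold y; lra.
  - apply is_pseries_CV_radius with (f y), Hf.
    rewrite Hy; unfold y; lra.
Qed.

Lemma is_pseries_unique_coef (u v : nat -> R) (f : R -> R) (r : R) :
  0 < r ->
  (forall t, Rabs t < r -> is_pseries u t (f t)) ->
  (forall t, Rabs t < r -> is_pseries v t (f t)) ->
  forall n, u n = v n.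
Proof.
  intros Hr Hu Hv n.
  assert (H0 : Rabs 0 < r) by (rewrite Rabs_R0; exact Hr).
  apply PSeries_ext_recip.
  - rewrite <- Rabs_R0; exact (is_pseries_CV_radius_lt u f r 0 Hu H0).
  - rewrite <- Rabs_R0; exact (is_pseries_CV_radius_lt v f r 0 Hv H0).
  - exists (mkposreal r Hr); intros t Ht.
    assert (Ht' : Rabs t < r).
    { replace t with (t - 0) by ring; exact Ht. }
    rewrite (is_pseries_unique _ _ _ (Hu t Ht')).
    rewrite (is_pseries_unique _ _ _ (Hv t Ht')).
    reflexivity.
Qed.

Lemma is_pseries_exp_scal (c t : R) :
  is_pseries (fun n => c ^ n / INR (fact n)) t (exp (c * t)).
Proof.
  pose proof (is_exp_Reals (c * t)) as H.
  apply is_pseries_R in H; apply is_pseries_R.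
  eapply is_series_ext; [| exact H].
  intros n; simpl; rewrite Rpow_mult_distr; unfold Rdiv; ring.
Qed.

(** The functional equation of the generating function; it comes from
    [b^t = a^t * exp ((ln b - ln a) t)]. *)
Lemma genocchi_functional_equation (a b t : R) :
  2 * t / (Rpower b t + Rpower a t)
  + 2 * t / (Rpower b t + Rpower a t) * exp ((ln b - ln a) * t)
  = t * (2 * exp (- ln a * t)).
Proof.
  unfold Rpower.
  replace ((ln b - ln a) * t) with (t * ln b + - (t * ln a)) by ring.
  replace (- ln a * t) with (- (t * ln a)) by ring.
  rewrite exp_plus, exp_Ropp.
  pose proof (exp_pos (t * ln a)); pose proof (exp_pos (t * ln b)).
  field; lra.
Qed.

Lemma genocchi_radius_pos (a b : R) :
  0 < a -> 0 < b -> a <> b -> 0 < PI / Rabs (ln a - ln b).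
Proof.
  intros ha hb hab.
  apply Rdiv_lt_0_compat; [exact PI_RGT_0 |].
  apply Rabs_pos_lt; intros H.
  apply hab, ln_inv; lra.
Qed.

(** Equality of the Taylor coefficients in the functional equation.  The
    right-hand side is kept as a shifted sequence, so that the cases [n = 0]
    and [n > 0] follow by computation. *)
Lemma genocchi_coef (a b : R) (G : nat -> R) :
  0 < a -> 0 < b -> a <> b -> is_genocchi_type a b G ->
  forall n,
    G n / INR (fact n)
    + sum_f_R0 (fun k => G k / INR (fact k)
                         * ((ln b - ln a) ^ (n - k) / INR (fact (n - k)))) n
    = PS_incr_1 (fun m => 2 * ((- ln a) ^ m / INR (fact m))) n.
Proof.
  intros ha hb hab hG n.
  pose proof (genocchi_radius_pos a b ha hb hab) as Hr.
  set (r := PI / Rabs (ln a - ln b)) in *.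
  set (F := fun t => 2 * t / (Rpower b t + Rpower a t)).
  set (g := fun k => G k / INR (fact k)).
  set (e := fun k => (ln b - ln a) ^ k / INR (fact k)).
  assert (Hg : forall t, Rabs t < r -> is_pseries g t (F t)).
  { intros t Ht; apply is_pseries_R.
    eapply is_series_ext; [| exact (hG t Ht)].
    intros k; unfold g; simpl; unfold Rdiv; ring. }
  assert (He : forall t, is_pseries e t (exp ((ln b - ln a) * t))).
  { intros t; apply is_pseries_exp_scal. }
  change (PS_plus g (PS_mult g e) n
          = PS_incr_1 (fun m => 2 * ((- ln a) ^ m / INR (fact m))) n).
  apply is_pseries_unique_coef
    with (r := r) (f := fun t => t * (2 * exp (- ln a * t))); [exact Hr | |].
  - intros t Ht.
    rewrite <- (genocchi_functional_equation a b t).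
    apply (is_pseries_plus g (PS_mult g e)); [exact (Hg t Ht) |].
    apply is_pseries_mult; [exact (Hg t Ht) | exact (He t) | |].
    + exact (is_pseries_CV_radius_lt g F r t Hg Ht).
    + exact (is_pseries_CV_radius_lt e _ r t (fun s _ => He s) Ht).
  - intros t _.
    apply (is_pseries_incr_1 (fun m => 2 * ((- ln a) ^ m / INR (fact m))) t).
    apply (is_pseries_scal 2 (fun m => (- ln a) ^ m / INR (fact m)) t);
      [apply Rmult_comm | apply is_pseries_exp_scal].
Qed.

Theorem mainTheorem2 (a b : R) (ha : 0 < a) (hb : 0 < b) (hab : a <> b)
    (G : nat -> R) (hG : is_genocchi_type a b G) :
  G 0%nat = 0 /\ G 1%nat = 1 /\
  forall n : nat, (2 <= n)%nat ->
    G n + sum_f_R0 (fun k : nat =>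
            Binomial.C n k * (ln b - ln a) ^ (n - k) * G k) n
    = 2 * INR n * ln (1 / a) ^ (n - 1).
Proof.
  pose proof (genocchi_coef a b G ha hb hab hG) as H.
  assert (H0 : G 0%nat = 0).
  { specialize (H 0%nat); simpl in H; change (@zero _) with 0 in H; lra. }
  split; [exact H0 | split].
  - specialize (H 1%nat); simpl in H; rewrite H0 in H; lra.
  - intros n Hn.
    destruct n as [| m]; [lia |].
    specialize (H (S m)).
    change (PS_incr_1 (fun m => 2 * ((- ln a) ^ m / INR (fact m))) (S m))
      with (2 * ((- ln a) ^ m / INR (fact m))) in H.
    replace (S m - 1)%nat with m by lia.
    replace (ln (1 / a)) with (- ln a)
      by (unfold Rdiv; rewrite Rmult_1_l, ln_Rinv; [reflexivity | exact ha]).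
    pose proof (INR_fact_neq_0 (S m)) as Hf.
    pose proof (INR_fact_neq_0 m) as Hfm.
    transitivity (INR (fact (S m)) * (2 * ((- ln a) ^ m / INR (fact m)))).
    + rewrite <- H, Rmult_plus_distr_l, scal_sum.
      f_equal; [field; exact Hf |].
      apply sum_eq; intros k _.
      unfold Binomial.C.
      field; split; apply INR_fact_neq_0.
    + rewrite fact_simpl, mult_INR; field; exact Hfm.
Qed.
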